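(* Let $X$ be a Banach space, $(\Omega,\Sigma,\mu)$ be a complete $\sigma$-finite measure space and $E$ be a Köthe space on $(\Omega,\Sigma,\mu)$. Suppose that there exists a dense subset $\mathcal{A}\subseteq S_{E(X)}$ such that for every $f\in\mathcal{A}$ there is $\Phi_f\in E'(X^*,w^* )$ satisfying $\bigl\|\,\|\Phi_f(\cdot)\|_{X^*}\bigr\|_{E'}=\langle\Phi_f,f\rangle=1$. Then $n_L(E(X))\le n_L(X)$.
   Context: $X$ is a real or complex Banach space. $L_0(\mu)$ is the space of (classes of) $\Sigma$-measurable locally integrable functions $\Omega\to\mathbb{R}$. A Köthe (function) space on $(\Omega,\Sigma,\mu)$ is a linear subspace $E\subseteq L_0(\mu)$ that is a Banach space under a norm $\|\cdot\|_E$ such that (i) if $f \in L_0(\mu)$, $g\in E$ and $|f|\le|g|$ a.e., then $f\in E$ and $\|f\|_E\le\|g\|_E$; (ii) $\chi_A\in E$ for every $A\in\Sigma$ with $0<\mu(A)<\infty$. Its Köthe dual is $E'=\{g\in L_0(\mu):\|g\|_{E'}:=\sup_{f\in B_E}\int_\Omega|fg|\,d\mu<\infty\}$. A function $f:\Omega\to X$ is strongly measurable if it can be approximated almost everywhere by simple functions. The Köthe-Bochner space $E(X)$ is the space of (classes of) strongly measurable $f:\Omega\to X$ with $(t\mapsto\|f(t)\|_X)\in E$, normed by $\|f\|_{E(X)}=\bigl\|t\mapsto\|f(t)\|_X\bigr\|_E$; $S_{E(X)}$ is its unit sphere. $E'(X^*,w^* )$ is the space of $w^*$-scalarly measurable $\Phi:\Omega\to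 X^*$ (i.e. $t\mapsto\Phi(t)(x)$ is measurable for each $x\in X$) with $\|\Phi(\cdot)\|_{X^*}\in E'$, acting on $E(X)$ by $\langle\Phi,f\rangle=\int_\Omega\langle\Phi(t),f(t)\rangle\,d\mu(t)$. For a Banach space $Z$, $\mathrm{Lip}_0(Z,Z)$ is the space of Lipschitz maps $T:Z\to Z$ with $T(0)=0$ and norm $\|T\|_L=\sup_{x\ne y}\|Tx-Ty\|/\|x-y\|$; $D(z)=\{z^*\in Z^*: z^*(z)=\|z^*\|\|z\|=\|z\|^2\}$; $\nu_L(T)=\sup\left\{\frac{|z^*(Tx-Ty)|}{\|x-y\|^2}: x\ne y \text{ in } Z,\ z^*\in D(x-y)\right\}$; and $n_L(Z)=\inf\{\nu_L(T): T\in\mathrm{Lip}_0(Z,Z),\ \|T\|_L=1\}$. *)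

(* Defs.v *)
From HB Require Import structures.
From mathcomp Require Import all_boot all_order all_algebra.
From mathcomp Require Import all_classical all_reals all_analysis.
From mathcomp Require Import measurable_realfun complex.

Set Implicit Arguments.
Unset Strict Implicit.
Unset Printing Implicit Defensive.

Import Order.TTheory GRing.Theory Num.Theory.
Import numFieldNormedType.Exports.

Local Open Scope classical_set_scope.
Local Open Scope ring_scope.

Variant scalars := RealScalars | ComplexScalars.

Definition scalar_field (R : realType) (s : scalars) : numFieldType :=
  match s with RealScalars => R | ComplexScalars => R[i] end.

Section scalar_field.
Context (R : realType) (s : scalars).

Definition sre : scalar_field R s -> R :=
  match s as s0 return scalar_field R s0 -> R with
  | RealScalars => fun x => x
  | ComplexScalars => fun z => complex.Re z
  end.

Definition sim : scalar_field R s -> R :=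
  match s as s0 return scalar_field R s0 -> R with
  | RealScalars => fun=> 0
  | ComplexScalars => fun z => complex.Im z
  end.

Definition of_real : R -> scalar_field R s :=
  match s as s0 return R -> scalar_field R s0 with
  | RealScalars => fun x => x
  | ComplexScalars => fun x => Complex x 0
  end.

End scalar_field.
Arguments of_real {R s}.

Lemma of_realK (R : realType) s : cancel (@of_real R s) (@sre R s).
Proof. by case: s. Qed.

Lemma of_real_le (R : realType) s (x y : R) :
  (of_real x <= of_real y :> scalar_field R s) = (x <= y).
Proof. by case: s => //; exact: lecR. Qed.

Lemma of_realD (R : realType) s (x y : R) :
  of_real (x + y) = of_real x + of_real y :> scalar_field R s.
Proof. by case: s => //=; rewrite -[RHS](rmorphD (real_complex R)). Qed.

Lemma of_realM (R : realType) s (x y : R) :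
  of_real (x * y) = of_real x * of_real y :> scalar_field R s.
Proof. by case: s => //=; rewrite -[RHS](rmorphM (real_complex R)). Qed.

Lemma of_real0 (R : realType) s : of_real 0 = 0 :> scalar_field R s.
Proof. by case: s. Qed.

Lemma of_real_ge0 (R : realType) s (x : R) :
  (0 <= of_real x :> scalar_field R s) = (0 <= x).
Proof. by rewrite -of_real0 of_real_le. Qed.

Lemma of_real_sre (R : realType) s (z : scalar_field R s) :
  0 <= z -> of_real (sre z) = z.
Proof.
by case: s z => //= z z0; rewrite -[RHS]RRe_real// ger0_real.
Qed.

Section rnorm.
Context (R : realType) (s : scalars).
Local Notation K := (scalar_field R s).

(* The norm of a normedModType K is K-valued; this is the same norm with
   values in R. *)
Definition rnorm (V : normedZmodType K) (x : V) : R := sre `|x|.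

Lemma of_real_rnorm (V : normedZmodType K) (x : V) : of_real (rnorm x) = `|x|.
Proof. exact/of_real_sre/normr_ge0. Qed.

Lemma rnorm_ge0 (V : normedZmodType K) (x : V) : 0 <= rnorm x.
Proof. by rewrite -(@of_real_ge0 R s) of_real_rnorm. Qed.

Lemma rnormD (V : normedZmodType K) (x y : V) :
  rnorm (x + y) <= rnorm x + rnorm y.
Proof. by rewrite -(@of_real_le R s) of_realD !of_real_rnorm ler_normD. Qed.

Lemma rnormN (V : normedZmodType K) (x : V) : rnorm (- x) = rnorm x.
Proof. by rewrite /rnorm normrN. Qed.

Lemma rnorm_eq0 (V : normedZmodType K) (x : V) : rnorm x = 0 -> x = 0.
Proof. by move=> x0; apply/normr0_eq0; rewrite -of_real_rnorm x0 of_real0. Qed.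

Lemma rnorm0 (V : normedZmodType K) : rnorm (0 : V) = 0.
Proof. by rewrite /rnorm normr0 -of_real0 of_realK. Qed.

Lemma ler_rnorm_dist (V : normedZmodType K) (x y : V) :
  `|rnorm x - rnorm y| <= rnorm (x - y).
Proof.
rewrite ler_norml; apply/andP; split.
  rewrite lerNl opprB lerBlDr -[rnorm (x - y)]rnormN opprB.
  by rewrite -{1}(subrK x y) rnormD.
by rewrite lerBlDr -{1}(subrK y x) rnormD.
Qed.

Lemma rnormZ (V : normedModType K) (a : K) (x : V) :
  rnorm (a *: x) = rnorm a * rnorm x.
Proof.
by rewrite -[RHS](@of_realK R s) of_realM !of_real_rnorm /rnorm normrZ.
Qed.

Lemma cvg_rnorm (V : normedModType K) (u : nat -> V) (x : V) :
  u n @[n --> \oo] --> x -> rnorm (u n) @[n --> \oo] --> rnorm x.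
Proof.
move=> ux; apply/cvgrPdist_lt => e e0.
have oe0 : 0 < of_real e :> K.
  rewrite lt_neqAle of_real_ge0 ltW// andbT -of_real0.
  by rewrite (inj_eq (can_inj (@of_realK R s))) lt_eqF.
move/cvgrPdist_lt : ux => /(_ _ oe0); apply: filterS => n xun.
apply: le_lt_trans (ler_rnorm_dist _ _) _.
rewrite ltNge -(@of_real_le R s) of_real_rnorm; apply/negP => h.
by have := lt_le_trans xun h; rewrite ltxx.
Qed.

End rnorm.
Arguments rnorm {R s V} x.

Section lipschitz_numerical_index.
Context (R : realType) (s : scalars).
Local Notation K := (scalar_field R s).

Record dual (Z : normedModType K) := Dual {
  dual_fun :> {linear Z -> K^o} ;
  dual_continuous : continuous dual_fun }.

Definition dual_norm (Z : normedModType K) (phi : dual Z) : R :=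
  sup [set rnorm (phi z) | z in [set z | rnorm z <= 1]].

Definition duality_map (Z : normedModType K) (z : Z) : set (dual Z) :=
  [set phi : dual Z | phi z = of_real (dual_norm phi * rnorm z) /\
             dual_norm phi * rnorm z = rnorm z ^+ 2].

Definition Lip0 (Z : normedModType K) : set (Z -> Z) :=
  [set f | (exists k : K, k.-lipschitz f) /\ f 0 = 0].

Definition Lip_norm (Z : normedModType K) (f : Z -> Z) : R :=
  sup [set r | exists x y, x != y /\ r = rnorm (f x - f y) / rnorm (x - y)].

Definition nu_L (Z : normedModType K) (f : Z -> Z) : R :=
  sup [set r | exists x y, x != y /\ exists2 phi : dual Z,
    duality_map (x - y) phi & r = rnorm (phi (f x - f y)) / rnorm (x - y) ^+ 2].

(* In the degenerate case Z = {0} there is no f of norm 1, and the infimum of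
   the empty set is the library's default value 0. *)
Definition n_L (Z : normedModType K) : R :=
  inf [set @nu_L Z f | f in [set f | @Lip0 Z f /\ @Lip_norm Z f = 1]].

End lipschitz_numerical_index.

Section kothe_space.
Context d (T : measurableType d) (R : realType) (mu : {measure set T -> \bar R}).

(* Elements of L_0(mu) are handled through their representatives. *)
Definition L0 : set (T -> R) := [set f | measurable_fun setT f /\
  forall A, measurable A -> (mu A < +oo)%E -> mu.-integrable A (EFin \o f)].

(* By kothe_ideal, membership in E and the norm only depend on the class of a
   function modulo mu-a.e. equality. *)
Record kothe_space := KotheSpace {
  kothe_set :> (T -> R) -> Prop ;
  kothe_norm : (T -> R) -> R ;
  kothe_sub_L0 : forall f, kothe_set f -> L0 f ;
  kothe_zero : kothe_set (fun=> 0) ;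
  kothe_lin : forall (a : R) f g, kothe_set f -> kothe_set g ->
    kothe_set (fun t => a * f t + g t) ;
  kothe_normZ : forall (a : R) f, kothe_set f ->
    kothe_norm (fun t => a * f t) = `|a| * kothe_norm f ;
  kothe_normD : forall f g, kothe_set f -> kothe_set g ->
    kothe_norm (fun t => f t + g t) <= kothe_norm f + kothe_norm g ;
  kothe_norm_eq0 : forall f, kothe_set f -> kothe_norm f = 0 ->
    {ae mu, forall t, f t = 0} ;
  kothe_complete : forall u : nat -> T -> R, (forall n, kothe_set (u n)) ->
    (forall e : R, 0 < e -> exists N, forall m n, (N <= m)%N -> (N <= n)%N ->
      kothe_norm (fun t => u m t - u n t) < e) ->
    exists2 f, kothe_set f &
      kothe_norm (fun t => u n t - f t) @[n --> \oo] --> (0 : R) ;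
  kothe_ideal : forall f g, L0 f -> kothe_set g ->
    {ae mu, forall t, `|f t| <= `|g t|} ->
    kothe_set f /\ kothe_norm f <= kothe_norm g ;
  kothe_indic : forall A, measurable A -> (0 < mu A)%E -> (mu A < +oo)%E ->
    kothe_set (\1_A : T -> R) }.

Definition kothe_dual_norm (E : kothe_space) (g : T -> R) : \bar R :=
  ereal_sup [set (\int[mu]_t `|f t * g t|%:E)%E |
             f in [set f | E f /\ kothe_norm E f <= 1]].

Definition kothe_dual (E : kothe_space) : set (T -> R) :=
  [set g | L0 g /\ (kothe_dual_norm E g < +oo)%E].

End kothe_space.

Section kothe_theory.
Context d (T : measurableType d) (R : realType) (mu : {measure set T -> \bar R}).
Variable E : kothe_space mu.

Lemma kothe_norm_ge0 (f : T -> R) : E f -> 0 <= kothe_norm E f.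
Proof.
move=> Ef; have EN : E (fun t => -1 * f t).
  have := kothe_lin (-1) Ef (kothe_zero E).
  by congr (kothe_set E _); apply/funext => t; rewrite addr0.
have := kothe_normD Ef EN; rewrite kothe_normZ// normrN1 mul1r.
have -> : (fun t => f t + -1 * f t) = (fun t => 0 * f t).
  by apply/funext => t; rewrite mulN1r mul0r subrr.
by rewrite kothe_normZ// normr0 mul0r -mulr2n pmulrn_lge0.
Qed.

Lemma L0_le (f g : T -> R) : measurable_fun setT f -> L0 mu g ->
  (forall t, `|f t| <= `|g t|) -> L0 mu f.
Proof.
move=> mf [mg ig] fg; split=> // A mA fA.
apply: le_integrable (ig A mA fA) => //.
  exact/measurable_EFinP/measurable_funTS.
by move=> t _; rewrite /= lee_fin.
Qed.

Lemma kothe_le (f g : T -> R) : measurable_fun setT f -> E g ->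
  (forall t, `|f t| <= `|g t|) -> E f /\ kothe_norm E f <= kothe_norm E g.
Proof.
move=> mf Eg fg; apply: kothe_ideal => //; last exact: aeW.
exact: L0_le (kothe_sub_L0 Eg) fg.
Qed.

End kothe_theory.

Section kothe_bochner.
Context (R : realType) (s : scalars) d (T : measurableType d).
Local Notation K := (scalar_field R s).

Definition simple_function (X : normedModType K) (u : T -> X) :=
  finite_set (range u) /\ forall x, measurable (u @^-1` [set x]).

Definition strongly_measurable (mu : {measure set T -> \bar R})
    (X : normedModType K) (f : T -> X) :=
  exists2 u : nat -> T -> X, (forall n, simple_function (u n)) &
    {ae mu, forall t, u n t @[n --> \oo] --> f t}.

(* The completeness of mu is an argument because it is what makes the
   functions below closed under addition: t |-> `|f t + g t| has to be
   measurable. *)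
Definition kothe_bochner_pred (mu : {measure set T -> \bar R})
    (cmu : measure_is_complete mu) (E : kothe_space mu) (X : normedModType K)
  : {pred T -> X} :=
  [pred f : T -> X | `[< strongly_measurable mu f /\ E (rnorm \o f) >] ].
Arguments kothe_bochner_pred {mu} cmu E X.

Variables (mu : {measure set T -> \bar R}) (cmu : measure_is_complete mu).
Variables (E : kothe_space mu) (X : normedModType K).

Lemma simple_function_lin (a : K) (u v : T -> X) : simple_function u ->
  simple_function v -> simple_function (fun t => a *: u t + v t).
Proof.
move=> [fu mu'] [fv mv]; split.
  have := finite_image2 (fun x y => a *: x + y) fu fv.
  by apply: sub_finite_set => _ [t _ <-]; exists (u t) => //; exists (v t).
move=> x.
have -> : (fun t => a *: u t + v t) @^-1` [set x] =
  \bigcup_(y in range u) (u @^-1` [set y] `&` v @^-1` [set x - a *: y]).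
  apply/seteqP; split => [t /= <-|t [_ [t' _ <-] /= [-> ->]]].
    exists (u t); first by exists t.
    by split => //=; rewrite addrAC subrr add0r.
  by rewrite addrC subrK.
apply: fin_bigcup_measurable => // y _; exact: measurableI.
Qed.

Lemma simple_function_rnorm (u : T -> X) :
  simple_function u -> measurable_fun setT (rnorm \o u).
Proof.
move=> [fu mu'] _ B mB; rewrite setTI.
have -> : (rnorm \o u) @^-1` B =
  \bigcup_(y in range u `&` [set y | B (rnorm y)]) (u @^-1` [set y]).
  apply/seteqP; split => [t /= Bt|t [y [_ /= By] /= ->]//].
  by exists (u t) => //; split => //; exists t.
by apply: fin_bigcup_measurable => //; exact: finite_setIl.
Qed.

Lemma strongly_measurable_lin (a : K) (f g : T -> X) :
  strongly_measurable mu f -> strongly_measurable mu g ->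
  strongly_measurable mu (fun t => a *: f t + g t).
Proof.
move=> [u su uf] [v sv vg]; exists (fun n t => a *: u n t + v n t).
  by move=> n; exact: simple_function_lin.
apply: filterS2 uf vg => t uf vg; apply: cvgD => //; exact: cvgZr.
Qed.

Lemma ae_measurable_funR (f g : T -> R) : measure_is_complete mu ->
  {ae mu, forall t, f t = g t} -> measurable_fun setT f ->
  measurable_fun setT g.
Proof.
move=> c fg mf; apply/measurable_EFinP.
apply: (@ae_measurable_fun _ _ _ mu c setT (EFin \o f)).
  by apply: filterS fg => t /= -> _.
exact/measurable_EFinP.
Qed.

Lemma strongly_measurable_rnorm (f : T -> X) : measure_is_complete mu ->
  strongly_measurable mu f -> measurable_fun setT (rnorm \o f).
Proof.
move=> c [u su [N [mN N0 uf]]].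
have Nf t : ~ N t -> u n t @[n --> \oo] --> f t.
  by move=> Nt; apply: contrapT => h; apply/Nt/uf.
apply: (@ae_measurable_funR (fun t => \1_(~` N) t * rnorm (f t))) => //.
  exists N; split => // t /= h; apply: contrapT => Nt; apply: h.
  by rewrite indicE mem_set// mul1r.
apply: (@measurable_fun_cvg _ _ _ setT
    (fun n t => \1_(~` N) t * rnorm (u n t))).
  move=> n; apply: measurable_funM; last exact/simple_function_rnorm.
  exact/measurable_indic/measurableC.
move=> t _; have [Nt|Nt] := pselect (N t).
  have -> : \1_(~` N) t = 0 :> R by rewrite indicE memNset//= => /(_ Nt).
  by rewrite mul0r; under eq_fun do rewrite mul0r; exact: cvg_cst.
by apply: cvgM; [exact: cvg_cst|apply: cvg_rnorm; exact: Nf].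
Qed.

Lemma kothe_bochner_submod_closed :
  submod_closed (kothe_bochner_pred cmu E X).
Proof.
split.
  apply/asboolP; split.
    exists (fun _ _ => 0) => [n|]; last by apply: aeW => t; exact: cvg_cst.
    split; first by apply: (sub_finite_set _ (finite_set1 0)) => _ [t _ <-].
    move=> x; have [->|x0] := eqVneq x 0.
      by rewrite (_ : _ @^-1` _ = setT)//; apply/seteqP; split.
    rewrite (_ : _ @^-1` _ = set0)//; apply/seteqP; split => // t /= /esym.
    exact/eqP.
  rewrite (_ : _ \o _ = fun=> 0); first exact: kothe_zero.
  by apply/funext => t /=; rewrite rnorm0.
move=> a f g /asboolP[sf Ef] /asboolP[sg Eg]; apply/asboolP.
have sfg := strongly_measurable_lin a sf sg.
split => //.
have Eh := kothe_lin (rnorm a) Ef Eg.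
have [] // := kothe_le (strongly_measurable_rnorm cmu sfg) Eh.
move=> t /=; rewrite !ger0_norm ?rnorm_ge0 ?addr_ge0 ?mulr_ge0 ?rnorm_ge0//.
by rewrite (le_trans (rnormD _ _))// rnormZ.
Qed.

End kothe_bochner.
Arguments kothe_bochner_pred {R s d T mu} cmu E X.

HB.instance Definition _ (R : realType) (s : scalars) d (T : measurableType d)
    (mu : {measure set T -> \bar R}) (cmu : measure_is_complete mu)
    (E : kothe_space mu) (X : normedModType (scalar_field R s)) :=
  GRing.isSubmodClosed.Build _ _ (kothe_bochner_pred cmu E X)
    (kothe_bochner_submod_closed cmu E X).

Section kothe_bochner_space.
Context (R : realType) (s : scalars) d (T : measurableType d).
Context (mu : {measure set T -> \bar R}) (cmu : measure_is_complete mu).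
Context (E : kothe_space mu) (X : normedModType (scalar_field R s)).
Local Notation K := (scalar_field R s).

Record kothe_bochner_fun := KotheBochnerFun {
  kothe_bochner_val :> T -> X ;
  _ : kothe_bochner_val \in kothe_bochner_pred cmu E X }.

HB.instance Definition _ := [isSub for kothe_bochner_val].
HB.instance Definition _ := [Choice of kothe_bochner_fun by <:].
HB.instance Definition _ := [SubChoice_isSubLmodule of kothe_bochner_fun by <:].

Definition kothe_bochner_null : {pred kothe_bochner_fun} :=
  [pred f : kothe_bochner_fun | `[< {ae mu, forall t, f t = 0} >] ].

Lemma kothe_bochner_null_zmod_closed : zmod_closed kothe_bochner_null.
Proof.
split; first by apply/asboolP; exact: aeW.
move=> f g /asboolP f0 /asboolP g0; apply/asboolP.
apply: filterS2 f0 g0 => t f0 g0.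
have -> : (f - g) t = f t - g t by [].
by rewrite f0 g0 subrr.
Qed.

HB.instance Definition _ := GRing.isZmodClosed.Build _ kothe_bochner_null
  kothe_bochner_null_zmod_closed.

Definition kothe_bochner : Type :=
  ring_quotient.Quotient.quot kothe_bochner_null.

HB.instance Definition _ := GRing.Zmodule.on kothe_bochner.
HB.instance Definition _ := EqQuotient.on kothe_bochner.

Local Open Scope quotient_scope.

Lemma kothe_bochner_eqP (f g : kothe_bochner_fun) :
  reflect {ae mu, forall t, f t = g t}
    (\pi_kothe_bochner f == \pi_kothe_bochner g).
Proof.
rewrite -ring_quotient.Quotient.idealrBE.
apply: (iffP (asboolP _)); apply: filterS => t.
  by have -> : (f - g) t = f t - g t by []; move/subr0_eq.
by have -> : (f - g) t = f t - g t by []; move=> ->; rewrite subrr.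
Qed.

Definition kothe_bochner_scale (a : K) (f : kothe_bochner) : kothe_bochner :=
  \pi_kothe_bochner (a *: repr f).

Definition kothe_bochner_norm (f : kothe_bochner) : K :=
  of_real (kothe_norm E (rnorm \o repr f)).

Lemma kothe_bochner_repr_pi (f : kothe_bochner_fun) :
  {ae mu, forall t, repr (\pi_kothe_bochner f) t = f t}.
Proof. by apply/kothe_bochner_eqP; rewrite reprK. Qed.

Lemma kothe_bochner_pi_scale (a : K) (f : kothe_bochner_fun) :
  kothe_bochner_scale a (\pi_kothe_bochner f) = \pi_kothe_bochner (a *: f).
Proof.
apply/eqP/kothe_bochner_eqP; apply: filterS (kothe_bochner_repr_pi f) => t ft.
have aE (g : kothe_bochner_fun) : (a *: g) t = a *: g t by [].
by rewrite !aE ft.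
Qed.

Lemma kothe_bochner_pi_add (f g : kothe_bochner_fun) :
  \pi_kothe_bochner f + \pi_kothe_bochner g = \pi_kothe_bochner (f + g).
Proof. exact/esym/ring_quotient.Quotient.pi_add. Qed.

Lemma kothe_bochner_scaleA (a b : K) (f : kothe_bochner) :
  kothe_bochner_scale a (kothe_bochner_scale b f) =
  kothe_bochner_scale (a * b) f.
Proof.
rewrite -[f]reprK [kothe_bochner_scale b _]kothe_bochner_pi_scale.
by rewrite !kothe_bochner_pi_scale scalerA.
Qed.

Lemma kothe_bochner_scale1 : left_id 1 kothe_bochner_scale.
Proof. by move=> f; rewrite -[f]reprK kothe_bochner_pi_scale scale1r. Qed.

Lemma kothe_bochner_scaleDr :
  right_distributive kothe_bochner_scale +%R.
Proof.
move=> a f g; rewrite -[f]reprK -[g]reprK kothe_bochner_pi_add.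
by rewrite !kothe_bochner_pi_scale kothe_bochner_pi_add scalerDr.
Qed.

Lemma kothe_bochner_scaleDl (f : kothe_bochner) :
  {morph kothe_bochner_scale^~ f : a b / a + b}.
Proof.
move=> a b; rewrite -[f]reprK !kothe_bochner_pi_scale.
by rewrite kothe_bochner_pi_add scalerDl.
Qed.

HB.instance Definition _ := GRing.Zmodule_isLmodule.Build K kothe_bochner
  kothe_bochner_scaleA kothe_bochner_scale1 kothe_bochner_scaleDr
  kothe_bochner_scaleDl.

Lemma kothe_bochner_fun_norm (f : kothe_bochner_fun) : E (rnorm \o f).
Proof. by case: f => f /= /asboolP[]. Qed.

Lemma kothe_norm_ae (f g : T -> R) : E f -> E g ->
  {ae mu, forall t, f t = g t} -> kothe_norm E f = kothe_norm E g.
Proof.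
move=> Ef Eg fg; apply/eqP; rewrite eq_le; apply/andP; split.
  apply: (proj2 (kothe_ideal (kothe_sub_L0 Ef) Eg _)).
  by apply: filterS fg => t ->.
apply: (proj2 (kothe_ideal (kothe_sub_L0 Eg) Ef _)).
by apply: filterS fg => t ->.
Qed.

Lemma kothe_bochner_norm_pi (f : kothe_bochner_fun) :
  kothe_bochner_norm (\pi_kothe_bochner f) =
  of_real (kothe_norm E (rnorm \o f)).
Proof.
congr of_real; apply: kothe_norm_ae; try exact: kothe_bochner_fun_norm.
by apply: filterS (kothe_bochner_repr_pi f) => t /= ->.
Qed.

Lemma kothe_bochner_normD (f g : kothe_bochner) :
  kothe_bochner_norm (f + g) <= kothe_bochner_norm f + kothe_bochner_norm g.
Proof.
rewrite -[f]reprK -[g]reprK kothe_bochner_pi_add !kothe_bochner_norm_pi.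
set f' := repr f; set g' := repr g.
have Ef := kothe_bochner_fun_norm f'; have Eg := kothe_bochner_fun_norm g'.
rewrite -of_realD of_real_le (le_trans _ (kothe_normD Ef Eg))//.
have Efg : E (fun t => rnorm (f' t) + rnorm (g' t)).
  have := kothe_lin 1 Ef Eg.
  by congr (kothe_set E _); apply/funext => t; rewrite mul1r.
apply: (proj2 (kothe_ideal (kothe_sub_L0 (kothe_bochner_fun_norm _)) Efg _)).
apply: aeW => t; rewrite !ger0_norm ?addr_ge0 ?rnorm_ge0//; exact: rnormD.
Qed.

Lemma kothe_bochner_normZ (a : K) (f : kothe_bochner) :
  kothe_bochner_norm (a *: f) = `|a| * kothe_bochner_norm f.
Proof.
rewrite -[f]reprK [X in kothe_bochner_norm X]kothe_bochner_pi_scale.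
rewrite !kothe_bochner_norm_pi -[`|a|]of_real_rnorm -of_realM; congr of_real.
rewrite -[rnorm a in RHS](ger0_norm (rnorm_ge0 a)) -kothe_normZ.
  by congr kothe_norm; apply/funext => t; exact: rnormZ.
exact: kothe_bochner_fun_norm.
Qed.

Lemma kothe_bochner_norm_eq0 (f : kothe_bochner) :
  kothe_bochner_norm f = 0 -> f = 0.
Proof.
rewrite -[f]reprK kothe_bochner_norm_pi -of_real0 => /(can_inj (@of_realK R s)).
move=> /(kothe_norm_eq0 (kothe_bochner_fun_norm _)) f0.
have -> : 0 = \pi_kothe_bochner (0 : kothe_bochner_fun).
  apply: (addrI (\pi_kothe_bochner (0 : kothe_bochner_fun))).
  by rewrite kothe_bochner_pi_add !addr0.
by apply/eqP/kothe_bochner_eqP; apply: filterS f0 => t /rnorm_eq0.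
Qed.

HB.instance Definition _ := Lmodule_isNormed.Build K kothe_bochner
  kothe_bochner_normD kothe_bochner_normZ kothe_bochner_norm_eq0.

End kothe_bochner_space.
Arguments kothe_bochner {R s d T mu} cmu E X.

Section pairing.
Context (R : realType) (s : scalars) d (T : measurableType d).
Local Notation K := (scalar_field R s).

Definition scalar_measurable (h : T -> K) :=
  measurable_fun setT (@sre R s \o h) /\ measurable_fun setT (@sim R s \o h).

Definition scalar_integral (mu : {measure set T -> \bar R}) : (T -> K) -> K :=
  match s as s0 return (T -> scalar_field R s0) -> scalar_field R s0 with
  | RealScalars => fun h => \int[mu]_t h t
  | ComplexScalars => fun h =>
      Complex (\int[mu]_t complex.Re (h t)) (\int[mu]_t complex.Im (h t))
  end.

Variables (mu : {measure set T -> \bar R}) (cmu : measure_is_complete mu).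
Variables (E : kothe_space mu) (X : normedModType K).

(* The space E'(X^*, w^* ). *)
Definition kothe_dual_wstar : set (T -> dual X) :=
  [set Phi : T -> dual X | (forall x, scalar_measurable (fun t => Phi t x)) /\
    kothe_dual E (fun t => dual_norm (Phi t))].

(* The value does not depend on the representative repr f. *)
Definition pairing (Phi : T -> dual X) (f : kothe_bochner cmu E X) : K :=
  scalar_integral mu (fun t => Phi t (repr f t)).

End pairing.

(* Main.v *)
(** A Lipschitz map T on X of norm 1 lifts to T' f = T o f on E(X), again of
    norm 1 (test T' on x 1_B with 0 < mu B < oo), so it suffices to see that
    nu_L T' <= nu_L T =: v. If f - g = c h with h in A, then Phi_h(t) attains
    its norm at h(t) for almost every t, hence a multiple of Phi_h(t) lies in
    D(f(t) - g(t)), and almost everywhere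
    |Phi_h(t) (T f(t) - T g(t))| <= v |Phi_h(t)| |f(t) - g(t)|.
    Integrating, |f - g - a (T' f - T' g)| >= (1 - |a| v) |f - g| for all
    scalars |a| <= 1. By density this holds for all f and g, and Lumer's
    argument turns it into nu_L T' <= v, with no need to know the other
    functionals in D(f - g). *)
From HB Require Import structures.
Require Import Defs.
From mathcomp Require Import all_boot all_order all_algebra.
From mathcomp Require Import all_classical all_reals all_analysis.
From mathcomp Require Import measurable_realfun complex ring lra.
Import Order.TTheory GRing.Theory Num.Theory.
Import numFieldNormedType.Exports.
Local Open Scope classical_set_scope.
Local Open Scope ring_scope.

Set Implicit Arguments.
Unset Strict Implicit.
Unset Printing Implicit Defensive.

Section scalar_theory.
Context {R : realType} {s : scalars}.
Local Notation K := (scalar_field R s).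

Lemma of_real1 : of_real 1 = 1 :> K.
Proof. by case: s. Qed.

Lemma of_real_inj : injective (@of_real R s).
Proof. exact: can_inj (@of_realK R s). Qed.

Lemma of_real_lt (x y : R) : (of_real x < of_real y :> K) = (x < y).
Proof. by rewrite !lt_neqAle of_real_le (inj_eq of_real_inj). Qed.

Lemma sreD (x y : K) : sre (x + y) = sre x + sre y.
Proof. by case: s x y => //= -[a b] [c e]. Qed.

Lemma sre_le_rnorm (z : K) : sre z <= rnorm z.
Proof.
rewrite -(@of_real_le R s) of_real_rnorm; case: s z => /= z.
  exact: ler_norm.
by apply: le_trans (normc_ge_Re z); rewrite lecR ler_norm.
Qed.

Lemma sreN (x : K) : sre (- x) = - sre x.
Proof. by case: s x => //= -[]. Qed.

Lemma ler_norm_sre (z : K) : `|sre z| <= rnorm z.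
Proof.
by rewrite ler_norml sre_le_rnorm andbT lerNl -sreN -[leRHS]rnormN sre_le_rnorm.
Qed.

Lemma sre_eq_rnorm (z : K) : sre z = rnorm z -> z = of_real (rnorm z).
Proof.
case: s z => /= [z h|[a b] /= h]; first by rewrite -h.
have h2 : rnorm (Complex a b : scalar_field R ComplexScalars) ^+ 2 =
    a ^+ 2 + b ^+ 2.
  by rewrite /rnorm /= sqr_sqrtr// addr_ge0// sqr_ge0.
rewrite /rnorm /= -h in h2 *; congr Complex; apply/eqP; rewrite -sqrf_eq0.
by rewrite -(addrI _ (etrans (addr0 _) h2)).
Qed.

Lemma rnorm_of_real (r : R) : 0 <= r -> rnorm (of_real r : K) = r.
Proof. by move=> r0; rewrite /rnorm ger0_norm ?of_realK// of_real_ge0. Qed.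

Lemma rnormM (a b : K) : rnorm (a * b) = rnorm a * rnorm b.
Proof. exact: (@rnormZ _ _ K^o a b). Qed.

Lemma exists_phase (z : K) :
  exists2 a : K, rnorm a <= 1 & a * z = of_real (rnorm z).
Proof.
have [->|z0] := eqVneq z 0.
  by exists 0; rewrite ?mul0r rnorm0 ?of_real0.
exists (of_real (rnorm z) / z); last by rewrite mulfVK.
by rewrite of_real_rnorm /rnorm normrM normfV normr_id mulfV ?normr_eq0//
  -of_real1 of_realK.
Qed.

Section dual_theory.
Variable Z : normedModType K.
Implicit Types (phi : dual Z) (z : Z).

Lemma dual_norm_has_sup phi :
  has_sup [set rnorm (phi z) | z in [set z | rnorm z <= 1]].
Proof.
split; first by exists (rnorm (phi 0)), 0 => //=; rewrite rnorm0.
have := linear_bounded_continuous phi.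
move=> [_ /(_ (@dual_continuous _ _ _ phi))] /linear_boundedP.
move=> /pinfty_ex_gt0[M M0 phiM].
exists (sre M) => _ [z /= z1 <-].
rewrite -(@of_real_le R s) of_real_rnorm (of_real_sre (ltW M0)).
apply: le_trans (phiM z) _; rewrite -[leRHS]mulr1 ler_wpM2l ?(ltW M0)//.
by rewrite -of_real_rnorm -of_real1 of_real_le.
Qed.

Lemma dual_norm_ge0 phi : 0 <= dual_norm phi.
Proof.
apply: le_trans (rnorm_ge0 (phi 0)) _.
apply: (ub_le_sup (dual_norm_has_sup phi).2).
by exists 0 => //=; rewrite rnorm0.
Qed.

Lemma rnorm_dual_le phi z : rnorm (phi z) <= dual_norm phi * rnorm z.
Proof.
have [z0|z0] := eqVneq (rnorm z) 0.
  by rewrite z0 mulr0 (rnorm_eq0 z0) linear0 rnorm0.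
have zp : 0 < rnorm z by rewrite lt_neqAle eq_sym z0 rnorm_ge0.
rewrite -ler_pdivrMr//.
apply: (ub_le_sup (dual_norm_has_sup phi).2).
exists (of_real (rnorm z)^-1 *: z).
  by rewrite /= rnormZ rnorm_of_real ?invr_ge0 ?rnorm_ge0// mulVf.
rewrite linearZ/= (@rnormZ _ _ K^o) rnorm_of_real ?invr_ge0 ?rnorm_ge0//.
by rewrite mulrC.
Qed.

Definition dual_scale_fun (a : K) phi : Z -> K^o := fun z => a *: phi z.

Fact dual_scale_linear a phi : linear (dual_scale_fun a phi).
Proof.
by move=> b x y; rewrite /dual_scale_fun linearP scalerDr !scalerA mulrC.
Qed.

HB.instance Definition _ a phi := GRing.isLinear.Build K Z K^o _
  (dual_scale_fun a phi) (dual_scale_linear a phi).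

Fact dual_scale_continuous a phi : continuous (dual_scale_fun a phi).
Proof. move=> z; apply: cvgZr; exact: dual_continuous. Qed.

Definition dual_scale a phi : dual Z :=
  Dual (dual_scale_continuous (a := a) (phi := phi)).

Lemma dual_scaleE a phi z : dual_scale a phi z = a * phi z.
Proof. by []. Qed.

Lemma dual_norm_scale_le a phi :
  dual_norm (dual_scale a phi) <= rnorm a * dual_norm phi.
Proof.
apply: ge_sup; first exact: (dual_norm_has_sup _).1.
move=> _ [z /= z1 <-]; rewrite dual_scaleE rnormM ler_wpM2l ?rnorm_ge0//.
apply: le_trans (rnorm_dual_le _ _) _.
by rewrite -[leRHS]mulr1 ler_wpM2l ?dual_norm_ge0.
Qed.

Lemma dual_normZ a phi : dual_norm (dual_scale a phi) = rnorm a * dual_norm phi.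
Proof.
apply/eqP; rewrite eq_le dual_norm_scale_le/=.
have [->|a0] := eqVneq a 0; first by rewrite rnorm0 mul0r dual_norm_ge0.
have ra : 0 < rnorm a.
  rewrite lt_neqAle rnorm_ge0 andbT eq_sym; apply: contra a0 => /eqP.
  by move=> /rnorm_eq0 ->.
rewrite mulrC -ler_pdivlMr//; apply: ge_sup.
  exact: (dual_norm_has_sup _).1.
move=> _ [z /= z1 <-]; rewrite ler_pdivlMr// mulrC -rnormM -dual_scaleE.
by apply: (ub_le_sup (dual_norm_has_sup _).2); exists z.
Qed.

End dual_theory.
End scalar_theory.

Lemma sup_ge0 (R : realType) (S : set R) :
  (forall r, S r -> 0 <= r) -> 0 <= sup S.
Proof.
move=> S0; have [supS|/sup_out->//] := pselect (has_sup S).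
have [r Sr] := supS.1.
by rewrite (le_trans (S0 r Sr))// (ub_le_sup supS.2).
Qed.

Section lipschitz_theory.
Context {R : realType} {s : scalars}.
Local Notation K := (scalar_field R s).
Variable Z : normedModType K.
Implicit Types (T : Z -> Z) (phi : dual Z) (x y z : Z).

Lemma rnorm_gt0 z : (0 < rnorm z) = (z != 0).
Proof.
rewrite lt_neqAle rnorm_ge0 andbT eq_sym; congr (~~ _).
by apply/eqP/eqP => [/rnorm_eq0//|->]; rewrite rnorm0.
Qed.

Lemma Lip0_has_ubound T : Lip0 T -> has_ubound
  [set r | exists x y, x != y /\ r = rnorm (T x - T y) / rnorm (x - y)].
Proof.
move=> [[k Tk] _]; exists (rnorm k) => _ [x [y [xy ->]]].
have xy0 : 0 < rnorm (x - y) by rewrite rnorm_gt0 subr_eq0.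
rewrite ler_pdivrMr// -(@of_real_le R s) of_realM !of_real_rnorm.
have kxy : `|T x - T y| <= k * `|x - y| := Tk (x, y) (conj I I).
rewrite (le_trans kxy)// -[X in _ <= _ * X]normr_id -normrM ger0_norm//.
exact: le_trans (normr_ge0 _) kxy.
Qed.

Lemma rnorm_Lip_le T x y : Lip0 T ->
  rnorm (T x - T y) <= Lip_norm T * rnorm (x - y).
Proof.
move=> LT; have [->|xy] := eqVneq x y; first by rewrite !subrr rnorm0 mulr0.
rewrite -ler_pdivrMr ?rnorm_gt0 ?subr_eq0//.
by apply: (ub_le_sup (Lip0_has_ubound LT)); exists x, y.
Qed.

Lemma dual_norm_duality z phi : z != 0 -> duality_map z phi ->
  dual_norm phi = rnorm z.
Proof.
rewrite -rnorm_gt0 => z0 [_ h]; apply: (mulIf (lt0r_neq0 z0)).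
by rewrite h expr2.
Qed.

Lemma nu_L_ubound T : Lip0 T -> ubound [set r | exists x y, x != y /\
  exists2 phi : dual Z, duality_map (x - y) phi
    & r = rnorm (phi (T x - T y)) / rnorm (x - y) ^+ 2] (Lip_norm T).
Proof.
move=> LT _ [x [y [xy [phi Dphi ->]]]]; move: xy; rewrite -subr_eq0 => xy.
rewrite ler_pdivrMr ?exprn_gt0 ?rnorm_gt0//.
apply: le_trans (rnorm_dual_le _ _) _.
rewrite (dual_norm_duality xy Dphi) expr2 mulrCA.
by rewrite ler_wpM2l ?rnorm_ge0 ?rnorm_Lip_le.
Qed.

Lemma nu_L_le T v : 0 <= v -> (forall x y phi, x != y ->
    duality_map (x - y) phi ->
    rnorm (phi (T x - T y)) <= v * rnorm (x - y) ^+ 2) ->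
  nu_L T <= v.
Proof.
move=> v0 Tv; rewrite /nu_L; set S := [set r | _].
have [->|S0] := eqVneq S set0; first by rewrite sup0.
apply: ge_sup; first exact/set0P.
move=> _ [x [y [xy [phi Dphi ->]]]].
by rewrite ler_pdivrMr ?exprn_gt0 ?rnorm_gt0 ?subr_eq0//; exact: Tv.
Qed.

Lemma nu_L_ge0 T : 0 <= nu_L T.
Proof.
apply: sup_ge0 => _ [x [y [_ [phi _ ->]]]].
by rewrite divr_ge0 ?rnorm_ge0 ?exprn_ge0 ?rnorm_ge0.
Qed.

Lemma n_L_ge0 : 0 <= n_L Z.
Proof.
rewrite /n_L; set S := [set nu_L _ | _ in _].
have [->|S0] := eqVneq S set0; first by rewrite inf0.
by apply: lb_le_inf; [exact/set0P|move=> _ [T _ <-]; exact: nu_L_ge0].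
Qed.

Lemma Lip_norm_ge0 T : 0 <= Lip_norm T.
Proof.
by apply: sup_ge0 => _ [x [y [_ ->]]]; rewrite divr_ge0 ?rnorm_ge0.
Qed.

Lemma nu_L_le_Lip_norm T : Lip0 T -> nu_L T <= Lip_norm T.
Proof.
move=> LT; apply: nu_L_le (Lip_norm_ge0 T) _ => x y phi xy Dphi.
rewrite -ler_pdivrMr ?exprn_gt0 ?rnorm_gt0 ?subr_eq0//.
by apply: (nu_L_ubound LT); exists x, y; split => //; exists phi.
Qed.

(* Rescaling phi to norm |x - y| puts it in the duality map of x - y. *)
Lemma rnorm_norming_le T x y phi : Lip0 T ->
  phi (x - y) = of_real (dual_norm phi * rnorm (x - y)) ->
  rnorm (phi (T x - T y)) <= nu_L T * (dual_norm phi * rnorm (x - y)).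
Proof.
move=> LT phixy.
have [->|xy] := eqVneq x y.
  by rewrite !subrr rnorm0 linear0 !rnorm0 !mulr0.
have [p0|p0] := eqVneq (dual_norm phi) 0.
  by apply: le_trans (rnorm_dual_le _ _) _; rewrite p0 !mul0r mulr0.
have pgt0 : 0 < dual_norm phi by rewrite lt_neqAle eq_sym p0 dual_norm_ge0.
have xygt0 : 0 < rnorm (x - y) by rewrite rnorm_gt0 subr_eq0.
set r := rnorm (x - y) / dual_norm phi.
have r0 : 0 < r by rewrite divr_gt0.
set psi := dual_scale (of_real r) phi.
have psiN : dual_norm psi = rnorm (x - y).
  by rewrite dual_normZ rnorm_of_real ?(ltW r0)// divfK.
have Dpsi : duality_map (x - y) psi.
  split; last by rewrite psiN expr2.
  by rewrite dual_scaleE phixy -of_realM psiN mulrA /r divfK.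
have : rnorm (psi (T x - T y)) / rnorm (x - y) ^+ 2 <= nu_L T.
  apply: (ub_le_sup (ex_intro _ _ (nu_L_ubound LT))).
  by exists x, y; split => //; exists psi.
rewrite dual_scaleE rnormM rnorm_of_real ?(ltW r0)// ler_pdivrMr ?exprn_gt0//.
rewrite -ler_pdivlMl// => /le_trans; apply.
rewrite le_eqVlt; apply/orP; left; apply/eqP; rewrite /r; field.
by rewrite p0 lt0r_neq0.
Qed.

(* Lumer's argument, carried out for a fixed pair: since T is not linear, the
   error in [(I - a T) o (I + a T) = I + O(a ^ 2)] is uniform only once x and y
   are fixed. *)
Lemma nu_L_le_expansive T v : Lip0 T -> Lip_norm T <= 1 -> 0 <= v <= 1 ->
  (forall x y (a : K), rnorm a <= 1 ->
    (1 - rnorm a * v) * rnorm (x - y) <=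
    rnorm (x - y - a *: (T x - T y))) ->
  nu_L T <= v.
Proof.
move=> LT T1 /andP[v0 v1] Texp; apply: nu_L_le => // x y phi xy Dphi.
have {}T1 u w : rnorm (T u - T w) <= rnorm (u - w).
  apply: le_trans (rnorm_Lip_le _ _ LT) _.
  by rewrite -[leRHS]mul1r ler_wpM2r ?rnorm_ge0.
set z := x - y; set S := T x - T y.
have z0 : z != 0 by rewrite subr_eq0.
have p0 : 0 < rnorm z by rewrite rnorm_gt0.
have phiN := dual_norm_duality z0 Dphi.
have [phiz _] := Dphi; rewrite phiN -/z in phiz.
have [th th1 thS] := exists_phase (phi S).
set m := rnorm (phi S); set p := rnorm z in p0 phiN phiz *.
set C := rnorm (T x) + rnorm (T y).
have m0 : 0 <= m by exact: rnorm_ge0.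
have C0 : 0 <= C by rewrite addr_ge0 ?rnorm_ge0.
have key (al : R) : 0 < al -> al < 1 -> m <= v * p ^+ 2 + al * (C * p + v * m).
  move=> al0 al1.
  set a := of_real al * th.
  have an : rnorm a <= al.
    by rewrite rnormM rnorm_of_real ?(ltW al0)// -[leRHS]mulr1 ler_wpM2l// ltW.
  have low : p ^+ 2 + al * m <= p * rnorm (z + a *: S).
    have := rnorm_dual_le phi (z + a *: S); rewrite phiN; apply: le_trans.
    rewrite linearD linearZ/= -[a *: _]/(a * _) -mulrA thS phiz.
    rewrite -of_realM -of_realD rnorm_of_real ?expr2//.
    by rewrite addr_ge0 ?mulr_ge0// ltW.
  set x' := x + a *: T x; set y' := y + a *: T y.
  have up : (1 - al * v) * rnorm (z + a *: S) <= p + al ^+ 2 * C.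
    have -> : z + a *: S = x' - y'.
      by rewrite /z /S /x' /y' scalerBr opprD addrACA.
    apply: (@le_trans _ _ ((1 - rnorm a * v) * rnorm (x' - y'))).
      by rewrite ler_wpM2r ?rnorm_ge0// lerB// ler_wpM2r.
    apply: le_trans (Texp x' y' a (le_trans an (ltW al1))) _.
    have -> : x' - y' - a *: (T x' - T y') =
        z + (a *: (T x - T x') - a *: (T y - T y')).
      rewrite /z {1}/x' {1}/y' !scalerBr !opprD !opprK.
      rewrite -!addrA; congr (x + _); rewrite !addrA; congr (_ + _).
      by rewrite addrAC [a *: T x + _]addrC -!addrA; congr (_ + (_ + _));
        rewrite addrC.
    apply: le_trans (rnormD _ _) _; rewrite lerD2l.
    apply: le_trans (rnormD _ _) _; rewrite rnormN !(rnormZ a) /C mulrDr.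
    have half u :
        rnorm a * rnorm (T u - T (u + a *: T u)) <= al ^+ 2 * rnorm (T u).
      rewrite expr2 -mulrA; apply: ler_pM; rewrite ?rnorm_ge0//.
      apply: le_trans (T1 _ _) _.
      rewrite opprD addrA subrr add0r rnormN rnormZ.
      by rewrite ler_wpM2r ?rnorm_ge0.
    by rewrite lerD ?half.
  have alv : 0 <= 1 - al * v by nra.
  have := ler_wpM2l alv low; rewrite mulrCA => h1.
  have := le_trans h1 (ler_wpM2l (ltW p0) up) => h2.
  rewrite -(ler_pM2l al0); move: h2; rewrite !expr2; nra.
apply/ler_addgt0Pr => e e0.
set D := C * p + v * m in key.
have D0 : 0 <= D by rewrite addr_ge0 ?mulr_ge0// ltW.
have De : 0 < 1 + e + D by lra.
apply: le_trans (key (e / (1 + e + D)) _ _) _.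
- by rewrite divr_gt0.
- by rewrite ltr_pdivrMr//; lra.
- by rewrite lerD2l mulrAC ler_pdivrMr//; nra.
Qed.

Lemma expansive_of_dense T (A : set Z) v : Lip0 T -> Lip_norm T <= 1 ->
  0 <= v <= 1 ->
  A `<=` [set h | `|h| = 1] -> [set h | `|h| = 1] `<=` closure A ->
  (forall x y h (c : R) (a : K), A h -> 0 < c -> x - y = of_real c *: h ->
    rnorm a <= 1 ->
    (1 - rnorm a * v) * c <= rnorm (x - y - a *: (T x - T y))) ->
  forall x y (a : K), rnorm a <= 1 ->
    (1 - rnorm a * v) * rnorm (x - y) <=
    rnorm (x - y - a *: (T x - T y)).
Proof.
move=> LT T1 /andP[v0 v1] A1 Ad TA x y a a1.
have {}T1 u w : rnorm (T u - T w) <= rnorm (u - w).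
  apply: le_trans (rnorm_Lip_le _ _ LT) _.
  by rewrite -[leRHS]mul1r ler_wpM2r ?rnorm_ge0.
have [->|xy] := eqVneq x y.
  by rewrite !subrr rnorm0 mulr0 rnorm_ge0.
set c := rnorm (x - y).
have c0 : 0 < c by rewrite rnorm_gt0 subr_eq0.
have oc0 : of_real c != 0 :> K.
  by rewrite -(of_real0 R s) (inj_eq of_real_inj) lt0r_neq0.
apply/ler_addgt0Pr => e e0.
set h0 := of_real c^-1 *: (x - y).
have h01 : `|h0| = 1.
  rewrite -of_real_rnorm rnormZ rnorm_of_real ?invr_ge0 ?(ltW c0)//.
  by rewrite mulVf ?of_real1// lt0r_neq0.
have ch0 : of_real c *: h0 = x - y.
  by rewrite scalerA -of_realM mulfV ?of_real1 ?scale1r// lt0r_neq0.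
set d := e / (2 * c).
have d0 : 0 < d by rewrite divr_gt0// mulr_gt0.
have od0 : 0 < of_real d :> K by rewrite -(of_real0 R s) of_real_lt.
have [h [Ah]] := Ad _ h01 _ (nbhsx_ballx h0 _ od0).
rewrite -ball_normE /ball_ /= -of_real_rnorm of_real_lt => hd.
set x' := y + of_real c *: h.
have x'y : x' - y = of_real c *: h by rewrite /x' addrC addKr.
have x'x : rnorm (x' - x) <= e / 2.
  have -> : x' - x = of_real c *: (h - h0).
    by rewrite scalerBr ch0 opprB /x' addrAC addrC.
  rewrite rnormZ rnorm_of_real ?(ltW c0)// -[rnorm (h - h0)]rnormN opprB.
  apply: le_trans (ler_wpM2l (ltW c0) (ltW hd)) _.
  rewrite le_eqVlt; apply/orP; left; apply/eqP; rewrite /d; field.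
  by rewrite lt0r_neq0.
apply: le_trans (TA x' y h c a Ah c0 x'y a1) _.
have -> : x' - y - a *: (T x' - T y) =
   (x - y - a *: (T x - T y)) + ((x' - x) - a *: (T x' - T x)).
  have -> : x' - y = (x - y) + (x' - x) by rewrite [RHS]addrC addrA subrK.
  have -> : T x' - T y = (T x - T y) + (T x' - T x).
    by rewrite [RHS]addrC addrA subrK.
  by rewrite scalerDr opprD addrACA.
apply: le_trans (rnormD _ _) _; rewrite lerD2l.
apply: le_trans (rnormD _ _) _; rewrite rnormN rnormZ.
have : rnorm a * rnorm (T x' - T x) <= 1 * (e / 2).
  by apply: ler_pM; rewrite ?rnorm_ge0// (le_trans (T1 _ _)).
by rewrite mul1r; lra.
Qed.

End lipschitz_theory.

Section norming.
Context {R : realType} {s : scalars} {d : measure_display}.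
Context {T : measurableType d} {mu : {measure set T -> \bar R}}.
Local Notation K := (scalar_field R s).
Variables (E : kothe_space mu) (X : normedModType K).
Implicit Types (f g : T -> R) (H : T -> X) (Phi : T -> dual X).

Lemma kotheZ (a : R) f : E f -> E (fun t => a * f t).
Proof.
move=> Ef; have := kothe_lin a Ef (kothe_zero E).
by congr (kothe_set E _); apply/funext => t; rewrite addr0.
Qed.

Lemma kothe_measurable f : E f -> measurable_fun setT f.
Proof. by move=> /kothe_sub_L0[]. Qed.

Lemma kothe_holder f g (c : R) : E f -> measurable_fun setT g ->
  (kothe_dual_norm E g <= 1)%E -> 0 < c -> kothe_norm E f <= c ->
  (\int[mu]_t `|f t * g t|%:E <= c%:E)%E.
Proof.
move=> Ef mg g1 c0 fc.
have mfg : measurable_fun setT (fun t => `|f t * g t|%:E).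
  apply/measurable_EFinP; apply: measurableT_comp => //.
  by apply: measurable_funM => //; exact: kothe_measurable.
have : (\int[mu]_t `|c^-1 * f t * g t|%:E <= 1)%E.
  apply: le_trans g1; apply: ereal_sup_ubound.
  exists (fun t => c^-1 * f t) => //=; split; first exact: kotheZ.
  by rewrite kothe_normZ// gtr0_norm ?invr_gt0// ler_pdivrMl// mulr1.
have -> : (\int[mu]_t `|c^-1 * f t * g t|%:E =
    c^-1%:E * \int[mu]_t `|f t * g t|%:E)%E.
  rewrite -ge0_integralZl// ?lee_fin ?invr_ge0 ?(ltW c0)//.
  apply: eq_integral => t _.
  by rewrite -mulrA normrM (gtr0_norm (x := c^-1)) ?invr_gt0// EFinM.
by rewrite lee_pdivrMl// mule1.
Qed.

Lemma simple_function_sre_measurable Phi H : simple_function H ->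
  (forall x, scalar_measurable (fun t => Phi t x)) ->
  measurable_fun setT (fun t => sre (Phi t (H t))).
Proof.
move=> [fH mH] mPhi _ B mB; rewrite setTI.
have -> : (fun t => sre (Phi t (H t))) @^-1` B = \bigcup_(y in range H)
    (H @^-1` [set y] `&` (fun t => sre (Phi t y)) @^-1` B).
  apply/seteqP; split => [t /= Bt|t [y _ [/= <-]]//].
  by exists (H t) => //; exists t.
apply: fin_bigcup_measurable => // y _; apply: measurableI => //.
by rewrite -[X in measurable X]setTI; apply: (mPhi y).1.
Qed.

Lemma cvg_sre (u : nat -> K) (z : K) : u n @[n --> \oo] --> z ->
  sre (u n) @[n --> \oo] --> sre z.
Proof.
move=> uz; apply/cvgrPdist_lt => e e0.
have oe0 : 0 < of_real e :> K by rewrite -(of_real0 R s) of_real_lt.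
move/cvgrPdist_lt : uz => /(_ _ oe0); apply: filterS => n.
rewrite -of_real_rnorm of_real_lt; apply: le_lt_trans.
by rewrite -sreN -sreD ler_norm_sre.
Qed.

Lemma strongly_measurable_sre Phi H : measure_is_complete mu ->
  strongly_measurable mu H ->
  (forall x, scalar_measurable (fun t => Phi t x)) ->
  measurable_fun setT (fun t => sre (Phi t (H t))).
Proof.
move=> c [u su [N [mN N0 uH]]] mPhi.
have NH t : ~ N t -> u n t @[n --> \oo] --> H t.
  by move=> Nt; apply: contrapT => h; apply/Nt/uH.
apply: (@ae_measurable_funR _ _ _ mu
    (fun t => \1_(~` N) t * sre (Phi t (H t)))) => //.
  exists N; split => // t /= h; apply: contrapT => Nt; apply: h.
  by rewrite indicE mem_set// mul1r.
apply: (@measurable_fun_cvg _ _ _ setT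
    (fun n t => \1_(~` N) t * sre (Phi t (u n t)))).
  move=> n; apply: measurable_funM; last exact/simple_function_sre_measurable.
  exact/measurable_indic/measurableC.
move=> t _; have [Nt|Nt] := pselect (N t).
  have -> : \1_(~` N) t = 0 :> R by rewrite indicE memNset//= => /(_ Nt).
  by rewrite mul0r; under eq_fun do rewrite mul0r; exact: cvg_cst.
apply: cvgM; [exact: cvg_cst|apply: cvg_sre].
apply: continuous_cvg; [exact: dual_continuous|exact: NH].
Qed.

Lemma sre_scalar_integral (h : T -> K) :
  sre (scalar_integral mu h) = \int[mu]_t sre (h t).
Proof. by case: s h. Qed.

(* Equality holds in [1 = \int Re <Phi, H> <= \int |Phi| |H| <= 1], hence
   almost everywhere under the integral. *)
Lemma norming_ae Phi H : measure_is_complete mu -> strongly_measurable mu H ->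
  E (rnorm \o H) -> kothe_norm E (rnorm \o H) <= 1 ->
  kothe_dual_wstar E Phi ->
  (kothe_dual_norm E (fun t => dual_norm (Phi t)) <= 1)%E ->
  scalar_integral mu (fun t => Phi t (H t)) = 1 ->
  {ae mu, forall t, Phi t (H t) = of_real (dual_norm (Phi t) * rnorm (H t))}
  /\ (\int[mu]_t (dual_norm (Phi t) * rnorm (H t))%:E = 1)%E.
Proof.
move=> cmu sH EH H1 [mPhi [[mN _] _]] N1 PhiH.
set g := fun t => dual_norm (Phi t) * rnorm (H t).
set f := fun t => sre (Phi t (H t)).
have g0 t : 0 <= g t by rewrite mulr_ge0 ?rnorm_ge0 ?dual_norm_ge0.
have rfg t : rnorm (Phi t (H t)) <= g t by exact: rnorm_dual_le.
have fg t : `|f t| <= g t.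
  by apply: le_trans (rfg t); exact: ler_norm_sre.
have mg : measurable_fun setT g.
  by apply: measurable_funM => //; exact: kothe_measurable EH.
have mf : measurable_fun setT f by exact: strongly_measurable_sre.
have ig1 : (\int[mu]_t (g t)%:E <= 1)%E.
  apply: le_trans (kothe_holder EH mN N1 ltr01 H1).
  rewrite le_eqVlt; apply/orP; left; apply/eqP; apply: eq_integral => t _.
  by rewrite /= [_ * dual_norm _]mulrC (ger0_norm (g0 t)).
have intg : mu.-integrable setT (EFin \o g).
  apply/integrableP; split; first exact/measurable_EFinP.
  apply: le_lt_trans (ltry 1); apply: le_trans ig1.
  rewrite le_eqVlt; apply/orP; left; apply/eqP; apply: eq_integral => t _.
  by rewrite /= ger0_norm.
have intf : mu.-integrable setT (EFin \o f).
  apply: le_integrable intg => //; first exact/measurable_EFinP.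
  by move=> t _; rewrite /= lee_fin (ger0_norm (g0 t)).
have if1 : (\int[mu]_t (f t)%:E = 1)%E.
  have := congr1 (@sre R s) PhiH.
  rewrite sre_scalar_integral -of_real1 of_realK /Rintegral => fin1.
  by rewrite -[LHS]fineK ?fin1// integrable_fin_num.
have ig : (\int[mu]_t (g t)%:E = 1)%E.
  apply/eqP; rewrite eq_le ig1/= -if1; apply: le_integral => // t _.
  by rewrite lee_fin (le_trans (ler_norm _)).
split => //.
have gf0 : (\int[mu]_t `|(EFin \o g) t - (EFin \o f) t| = 0)%E.
  transitivity (\int[mu]_t ((EFin \o g) t - (EFin \o f) t))%E.
    apply: eq_integral => t _; rewrite gee0_abs// sube_ge0// lee_fin.
    by rewrite (le_trans (ler_norm _)).
  by rewrite integralB//= ig if1 subee.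
have mgf : measurable_fun setT (fun t => (EFin \o g) t - (EFin \o f) t)%E.
  by apply: emeasurable_funB; exact/measurable_EFinP.
move/(ae_eq_integral_abs mu measurableT mgf) : gf0.
apply: filterS => t /(_ I)/eqP; rewrite sube_eq// add0e => /eqP[gft].
have rf : rnorm (Phi t (H t)) = g t.
  by apply/eqP; rewrite eq_le rfg gft sre_le_rnorm.
by rewrite [LHS]sre_eq_rnorm rf.
Qed.

End norming.

Section bochner_lift.
Context {R : realType} {s : scalars} {d : measure_display}.
Context {Omega : measurableType d} {mu : {measure set Omega -> \bar R}}.
Local Notation K := (scalar_field R s).
Context (cmu : measure_is_complete mu) (E : kothe_space mu).
Variable (X : normedModType K).
Local Notation EX := (kothe_bochner cmu E X).
Local Notation EXfun := (kothe_bochner_fun cmu E X).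
Local Open Scope quotient_scope.

Lemma kothe_bochner_fun_measurable (F : EXfun) : strongly_measurable mu F.
Proof. by case: F => F /= /asboolP[]. Qed.

Lemma rnorm_pi (F : EXfun) : rnorm (\pi_EX F) = kothe_norm E (rnorm \o F).
Proof. by rewrite -[RHS](@of_realK R s) -kothe_bochner_norm_pi. Qed.

Lemma kothe_bochner_pi_sub (F G : EXfun) : \pi_EX F - \pi_EX G = \pi_EX (F - G).
Proof. by apply/eqP; rewrite subr_eq kothe_bochner_pi_add subrK. Qed.

Lemma kothe_bochner_pi_scaler (a : K) (F : EXfun) :
  a *: \pi_EX F = \pi_EX (a *: F).
Proof. exact: kothe_bochner_pi_scale. Qed.

Variables (T : X -> X) (LT : Lip0 T).

Lemma rnorm_Lip0_le x : rnorm (T x) <= Lip_norm T * rnorm x.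
Proof. by have := rnorm_Lip_le x 0 LT; rewrite (proj2 LT) !subr0. Qed.

Lemma cvg_Lip0 (u : nat -> X) (x : X) :
  u n @[n --> \oo] --> x -> T (u n) @[n --> \oo] --> T x.
Proof.
move=> ux; apply/cvgrPdist_lt => e e0.
have re0 : 0 < sre e by rewrite -(@of_real_lt R s) of_real_sre ?ltW// of_real0.
have L1 : 0 < Lip_norm T + 1 by rewrite ltr_wpDl ?Lip_norm_ge0.
have oe0 : 0 < of_real (sre e / (Lip_norm T + 1)) :> K.
  by rewrite -(of_real0 R s) of_real_lt divr_gt0.
move/cvgrPdist_lt : ux => /(_ _ oe0); apply: filterS => n.
rewrite -!of_real_rnorm -[e in X in _ -> X](of_real_sre (ltW e0)) !of_real_lt.
rewrite ltr_pdivlMr// mulrC; apply: le_lt_trans.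
apply: le_trans (rnorm_Lip_le _ _ LT) _.
by rewrite ler_wpM2r ?rnorm_ge0// lerDl.
Qed.

Lemma simple_function_comp (u : Omega -> X) : simple_function u ->
  simple_function (T \o u).
Proof.
move=> [fu mu']; split.
  apply: sub_finite_set (finite_image T fu) => _ [t _ <-].
  by exists (u t) => //; exists t.
move=> x; have -> : (T \o u) @^-1` [set x] =
    \bigcup_(y in range u `&` [set y | T y = x]) (u @^-1` [set y]).
  apply/seteqP; split => [t /= Tut|t [y [_ /= <-] /= ->]//].
  by exists (u t) => //; split => //; exists t.
by apply: fin_bigcup_measurable => //; exact: finite_setIl.
Qed.

Lemma kothe_bochner_pred_comp (F : EXfun) :
  T \o F \in kothe_bochner_pred cmu E X.
Proof.
have sTF : strongly_measurable mu (T \o F).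
  have [u su uF] := kothe_bochner_fun_measurable F.
  exists (fun n => T \o u n) => [n|]; first exact: simple_function_comp.
  by apply: filterS uF => t; exact: cvg_Lip0.
apply/asboolP; split => //.
have EL := kotheZ (Lip_norm T) (kothe_bochner_fun_norm F).
have [] // := kothe_le (strongly_measurable_rnorm cmu sTF) EL.
move=> t /=; rewrite !ger0_norm ?mulr_ge0 ?rnorm_ge0 ?Lip_norm_ge0//.
exact: rnorm_Lip0_le.
Qed.

Definition lift_fun (F : EXfun) : EXfun :=
  KotheBochnerFun (kothe_bochner_pred_comp F).

Definition lift_map (f : EX) : EX := \pi_EX (lift_fun (repr f)).

Lemma lift_map_pi (F : EXfun) : lift_map (\pi_EX F) = \pi_EX (lift_fun F).
Proof.
apply/eqP/kothe_bochner_eqP.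
by apply: filterS (kothe_bochner_repr_pi F) => t /= ->.
Qed.

Lemma kothe_norm_le (f g : Omega -> R) : E f -> E g -> (forall t, 0 <= f t) ->
  (forall t, f t <= g t) -> kothe_norm E f <= kothe_norm E g.
Proof.
move=> Ef Eg f0 fg; apply: (kothe_le (kothe_measurable Ef) Eg _).2 => t.
by rewrite !ger0_norm// (le_trans (f0 t)).
Qed.

Lemma rnorm_lift_le (f g : EX) :
  rnorm (lift_map f - lift_map g) <= Lip_norm T * rnorm (f - g).
Proof.
rewrite -[f]reprK -[g]reprK !lift_map_pi !kothe_bochner_pi_sub !rnorm_pi.
set F := repr f; set G := repr g.
rewrite -[X in X * _]ger0_norm ?Lip_norm_ge0// -kothe_normZ; last first.
  exact: kothe_bochner_fun_norm.
apply: kothe_norm_le => [| |t|t].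
- exact: kothe_bochner_fun_norm.
- exact/kotheZ/kothe_bochner_fun_norm.
- exact: rnorm_ge0.
- exact: rnorm_Lip_le.
Qed.

Lemma Lip0_lift : Lip0 lift_map.
Proof.
split; last first.
  have -> : 0 = \pi_EX (0 : EXfun).
    by rewrite -(subrr (0 : EXfun)) -kothe_bochner_pi_sub subrr.
  rewrite lift_map_pi; apply/eqP/kothe_bochner_eqP/aeW => t /=.
  exact: (proj2 LT).
exists (of_real (Lip_norm T)) => -[f g] _ /=.
by rewrite -!of_real_rnorm -of_realM of_real_le rnorm_lift_le.
Qed.

Lemma Lip_norm_lift_le : Lip_norm lift_map <= Lip_norm T.
Proof.
rewrite {1}/Lip_norm; set S := [set r | _].
have [->|S0] := eqVneq S set0; first by rewrite sup0 Lip_norm_ge0.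
apply: ge_sup; first exact/set0P.
move=> _ [f [g [fg ->]]].
by rewrite ler_pdivrMr ?rnorm_gt0 ?subr_eq0// rnorm_lift_le.
Qed.

Lemma Lip_norm_lift_ge (B : set Omega) : measurable B ->
  (0 < mu B < +oo)%E -> Lip_norm T <= Lip_norm lift_map.
Proof.
move=> mB /andP[B0 Boo].
have EB := kothe_indic E mB B0 Boo.
have nB : 0 < kothe_norm E (\1_B : Omega -> R).
  rewrite lt_neqAle kothe_norm_ge0// andbT eq_sym; apply/eqP.
  move=> /(kothe_norm_eq0 EB)[N [mN N0 BN]].
  have : (mu B <= mu N)%E.
    apply: le_measure; rewrite ?inE// => t Bt; apply: BN => /=.
    by rewrite indicE mem_set//; apply/eqP/oner_neq0.
  by rewrite N0 leNgt B0.
have cP x : (fun t => (\1_B t : K) *: x) \in kothe_bochner_pred cmu E X.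
  apply/asboolP; split.
    exists (fun=> fun t => (\1_B t : K) *: x); last first.
      by apply: aeW => t; exact: cvg_cst.
    move=> _; split.
      apply: (sub_finite_set _ (finite_set2 x 0)) => _ [t _ <-].
      rewrite indicE; case: (t \in B); rewrite ?scale1r ?scale0r.
        by left.
      by right.
    move=> y.
    have -> : (fun t => (\1_B t : K) *: x) @^-1` [set y] =
        (B `&` [set t | x = y]) `|` (~` B `&` [set t | 0 = y]).
      apply/seteqP; split => t /=; rewrite indicE.
        case: (boolP (t \in B)); rewrite ?inE ?scale1r ?scale0r; first by left.
        by move=> /negP; rewrite inE; right.
      move=> [[Bt <-]|[Bt <-]]; first by rewrite mem_set// scale1r.
      by rewrite memNset// scale0r.
    have mP (P : Prop) : measurable [set t : Omega | P].
      have [p|np] := pselect P.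
        by rewrite (_ : [set _ | _] = setT)//; apply/seteqP; split.
      by rewrite (_ : [set _ | _] = set0)//; apply/seteqP; split.
    by apply: measurableU; apply: measurableI => //; exact: measurableC.
  have -> : rnorm \o (fun t => (\1_B t : K) *: x) = (fun t => rnorm x * \1_B t).
    apply/funext => t /=; rewrite rnormZ !indicE mulrC; congr (_ * _).
    by case: (t \in B); rewrite /= ?rnorm0// -of_real1 rnorm_of_real.
  exact: kotheZ.
pose C x : EXfun := KotheBochnerFun (cP x).
have nC x y : rnorm (\pi_EX (C x) - \pi_EX (C y)) =
    rnorm (x - y) * kothe_norm E (\1_B : Omega -> R).
  rewrite kothe_bochner_pi_sub rnorm_pi -[rnorm (x - y)]ger0_norm ?rnorm_ge0//.
  rewrite -kothe_normZ//; congr kothe_norm; apply/funext => t.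
  rewrite -[LHS]/(rnorm ((\1_B t : K) *: x - (\1_B t : K) *: y)) -scalerBr.
  rewrite rnormZ !indicE mulrC; congr (_ * _).
  by case: (t \in B); rewrite /= ?rnorm0// -of_real1 rnorm_of_real.
have liftC x : lift_map (\pi_EX (C x)) = \pi_EX (C (T x)).
  rewrite lift_map_pi; apply/eqP/kothe_bochner_eqP/aeW => t /=.
  by rewrite indicE; case: (t \in B); rewrite ?scale1r// !scale0r (proj2 LT).
rewrite {1}/Lip_norm; set S := [set r | _].
have [->|S0] := eqVneq S set0; first by rewrite sup0 Lip_norm_ge0.
apply: ge_sup; first exact/set0P.
move=> _ [x [y [xy ->]]].
rewrite ler_pdivrMr ?rnorm_gt0 ?subr_eq0// -(ler_pM2r nB) -mulrA -!nC -!liftC.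
exact: rnorm_Lip_le Lip0_lift.
Qed.

Lemma lift_expansive Phi (f g h : EX) (c : R) (a : K) : Lip_norm T <= 1 ->
  kothe_dual_wstar E Phi ->
  (kothe_dual_norm E (fun t => dual_norm (Phi t)) <= 1)%E ->
  pairing Phi h = 1 -> rnorm h <= 1 -> 0 < c -> f - g = of_real c *: h ->
  rnorm a <= 1 ->
  (1 - rnorm a * nu_L T) * c <= rnorm (f - g - a *: (lift_map f - lift_map g)).
Proof.
move=> T1 wPhi N1 Ph h1 c0 fg a1.
have v1 := le_trans (nu_L_le_Lip_norm LT) T1.
have v0 := nu_L_ge0 T.
set v := nu_L T in v0 v1 *.
set F := repr f; set G := repr g; set H := repr h.
have rH : rnorm h = kothe_norm E (rnorm \o H) by rewrite -{1}[h]reprK rnorm_pi.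
have [PhiH intPhiH] := norming_ae cmu (kothe_bochner_fun_measurable H)
  (kothe_bochner_fun_norm H) (eq_ind _ (fun r => r <= 1) h1 _ rH) wPhi N1 Ph.
have FGH : {ae mu, forall t, F t - G t = of_real c *: H t}.
  have/eqP : \pi_EX (F - G) = \pi_EX (of_real c *: H).
    by rewrite -kothe_bochner_pi_sub -kothe_bochner_pi_scaler !reprK.
  by move/kothe_bochner_eqP.
set U : EXfun := F - G - a *: (lift_fun F - lift_fun G).
have -> : f - g - a *: (lift_map f - lift_map g) = \pi_EX U.
  rewrite -[f]reprK -[g]reprK !lift_map_pi [X in a *: X]kothe_bochner_pi_sub.
  by rewrite kothe_bochner_pi_scaler !kothe_bochner_pi_sub.
rewrite rnorm_pi.
have UE t : U t = F t - G t - a *: (T (F t) - T (G t)) by [].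
have av : 0 <= 1 - rnorm a * v.
  by rewrite subr_ge0 -[leRHS]mulr1 ler_pM ?rnorm_ge0.
have mN : measurable_fun setT (fun t => dual_norm (Phi t)).
  by have [_ [[]]] := wPhi.
have EU := kothe_bochner_fun_norm U.
have pointwise : {ae mu, forall t,
    (1 - rnorm a * v) * c * (dual_norm (Phi t) * rnorm (H t)) <=
    `|rnorm (U t) * dual_norm (Phi t)|}.
  apply: filterS2 PhiH FGH => t PhiHt FGt.
  set N := dual_norm (Phi t) in PhiHt *.
  have N0 : 0 <= N by exact: dual_norm_ge0.
  have FGn : rnorm (F t - G t) = c * rnorm (H t).
    by rewrite FGt rnormZ rnorm_of_real// ltW.
  have PhiFG : Phi t (F t - G t) = of_real (N * rnorm (F t - G t)).
    rewrite {1}FGt linearZ/= PhiHt -[LHS]/(of_real c * of_real (N * _)).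
    by rewrite -of_realM FGn mulrCA.
  have := rnorm_norming_le LT PhiFG; rewrite -/N -/v FGn => TFG.
  rewrite ger0_norm ?mulr_ge0 ?rnorm_ge0// [leRHS]mulrC.
  apply: le_trans (rnorm_dual_le (Phi t) (U t)).
  have -> : Phi t (U t) = Phi t (F t - G t) - a * Phi t (T (F t) - T (G t)).
    by rewrite UE linearB linearZ.
  have := ler_rnorm_dist (Phi t (F t - G t) : K)
    (a * Phi t (T (F t) - T (G t))).
  move=> /(le_trans (ler_norm _)); apply: le_trans.
  rewrite PhiFG rnorm_of_real ?mulr_ge0 ?rnorm_ge0// rnormM FGn.
  rewrite mulrBl mul1r mulrBl lerB//; first by rewrite mulrCA.
  rewrite -!mulrA; apply: ler_wpM2l; rewrite ?rnorm_ge0//.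
  by rewrite [c * (N * _)]mulrCA.
apply/ler_addgt0Pr => e e0.
have Ue0 : 0 < kothe_norm E (rnorm \o U) + e.
  by rewrite ltr_wpDl// kothe_norm_ge0.
rewrite -lee_fin.
apply: le_trans (kothe_holder EU mN N1 Ue0 _); last by rewrite lerDl ltW.
rewrite -[leLHS]mule1 -intPhiH.
have mNH : measurable_fun setT (fun t => dual_norm (Phi t) * rnorm (H t)).
  apply: measurable_funM => //.
  exact/kothe_measurable/kothe_bochner_fun_norm.
rewrite -ge0_integralZl//; last 3 first.
- exact/measurable_EFinP.
- by move=> t _; rewrite lee_fin mulr_ge0 ?dual_norm_ge0 ?rnorm_ge0.
- by rewrite lee_fin mulr_ge0// ltW.
apply: ae_ge0_le_integral => //.
- move=> t _; rewrite -EFinM lee_fin.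
  by rewrite !mulr_ge0 ?dual_norm_ge0 ?rnorm_ge0// ltW.
- by apply/measurable_EFinP; apply: measurable_funM.
- apply/measurable_EFinP; apply: measurableT_comp => //.
  by apply: measurable_funM => //; exact: kothe_measurable EU.
- by apply: filterS pointwise => t h0 _; rewrite -EFinM lee_fin.
Qed.

End bochner_lift.

Lemma Lip_norm_id (R : realType) (s : scalars)
    (X : normedModType (scalar_field R s)) (x : X) : x != 0 ->
  Lip0 (@idfun X) /\ Lip_norm (@idfun X) = 1.
Proof.
move=> x0; split.
  by split => //; exists 1 => -[u v] _ /=; rewrite mul1r.
rewrite /Lip_norm (_ : [set r | _] = [set 1]) ?sup1//.
apply/seteqP; split => r /=.
  by move=> [u [v [uv ->]]]; rewrite divff// lt0r_neq0// rnorm_gt0 subr_eq0.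
move=> ->; exists x, 0; split => //.
by rewrite divff// lt0r_neq0// rnorm_gt0 subr_eq0.
Qed.

Lemma n_L_trivial (R : realType) (s : scalars)
    (Z : normedModType (scalar_field R s)) : (forall z : Z, z = 0) -> n_L Z = 0.
Proof.
move=> Z0; rewrite /n_L (_ : [set nu_L _ | _ in _] = set0) ?inf0//.
apply/seteqP; split => // r [T [_ T1] _].
move: T1; rewrite /Lip_norm (_ : [set r | _] = set0).
  by rewrite sup0 => /eqP; rewrite eq_sym oner_eq0.
by apply/seteqP; split => // q [x [y []]]; rewrite (Z0 x) (Z0 y) eqxx.
Qed.

Lemma kothe_bochner_eq0 (R : realType) (s : scalars) d (T : measurableType d)
    (mu : {measure set T -> \bar R}) (cmu : measure_is_complete mu)
    (E : kothe_space mu) (X : normedModType (scalar_field R s))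
    (f : kothe_bochner cmu E X) :
  {ae mu, forall t, repr f t = 0} -> f = 0.
Proof.
move=> f0; rewrite -[f]reprK.
rewrite -(subrr (\pi_(kothe_bochner cmu E X)%qT
  (0 : kothe_bochner_fun cmu E X))).
rewrite kothe_bochner_pi_sub subrr.
exact/eqP/kothe_bochner_eqP.
Qed.

Lemma sigma_finite_null_or_pos (R : realType) d (T : measurableType d)
    (mu : {sigma_finite_measure set T -> \bar R}) :
  mu setT = 0%E \/ exists2 B, measurable B & (0 < mu B < +oo)%E.
Proof.
have [[B mB B0]|nB] := pselect (exists2 B, measurable B & (0 < mu B < +oo)%E).
  by right; exists B.
left; have [F FT mF] := sigma_finiteT mu.
apply: measure_negligible => //; rewrite FT; apply: negligible_bigcup => k.
have [mFk Fkoo] := mF k.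
apply/negligibleP => //; apply/eqP; apply: contrapT => /negP Fk0; apply: nB.
by exists (F k) => //; rewrite Fkoo lt0e Fk0 measure_ge0.
Qed.

Theorem theorem4p5 (R : realType) (s : scalars)
  (X : completeNormedModType (scalar_field R s))
  (d : measure_display) (Omega : measurableType d)
  (mu : {sigma_finite_measure set Omega -> \bar R})
  (cmu : measure_is_complete mu) (E : kothe_space mu)
  (A : set (kothe_bochner cmu E X))
  (A_sphere : A `<=` [set f | `|f| = 1])
  (A_dense : [set f | `|f| = 1] `<=` closure A)
  (A_norming : forall f, A f ->
    exists Phi : Omega -> dual X,
      [/\ kothe_dual_wstar E Phi,
          kothe_dual_norm E (fun t => dual_norm (Phi t)) = 1%E
        & pairing Phi f = 1]) :
  n_L (kothe_bochner cmu E X) <= n_L X.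
Proof.
have [mu0|[B mB B0]] := sigma_finite_null_or_pos mu.
  rewrite n_L_trivial ?n_L_ge0// => f; apply: kothe_bochner_eq0.
  by exists setT.
have [[x x0]|X0] := pselect (exists x : X, x != 0); last first.
  have {}X0 x : x = 0 :> X.
    by apply: contrapT => /eqP x0; apply: X0; exists x.
  rewrite n_L_trivial ?n_L_ge0// => f; apply: kothe_bochner_eq0.
  by apply: aeW => t; exact: X0.
apply: lb_le_inf => [|_ [T [LT T1] <-]].
  by have Lid := Lip_norm_id x0; exists (nu_L (@idfun X)), idfun.
pose T' : kothe_bochner cmu E X -> _ := lift_map LT.
have LT' : Lip0 T' := Lip0_lift cmu E LT.
have T'1 : Lip_norm T' = 1.
  apply/eqP; rewrite eq_le -{1}T1 Lip_norm_lift_le/= -{1}T1.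
  exact: Lip_norm_lift_ge mB B0.
have v01 : 0 <= nu_L T <= 1 by rewrite nu_L_ge0 -T1 nu_L_le_Lip_norm.
apply: (@le_trans _ _ (nu_L T')).
  apply: ge_inf; last by exists T'.
  by exists 0 => _ [S _ <-]; exact: nu_L_ge0.
have T'le : Lip_norm T' <= 1 by rewrite T'1.
apply: nu_L_le_expansive => //.
apply: (expansive_of_dense LT' T'le v01 A_sphere A_dense).
move=> f g h c a Ah c0 fg a1.
have [Phi [wPhi N1 Ph]] := A_norming h Ah.
apply: (lift_expansive LT _ wPhi _ Ph _ c0 fg a1); rewrite ?T1 ?N1//.
by rewrite /rnorm (A_sphere h Ah) -of_real1 of_realK.
Qed.
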